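(* Let $\lambda,\mu>0$ and let $\Theta$ have the inverse Gaussian density $f_\Theta(x)=\sqrt{\lambda/(2\pi)}\,x^{-3/2}\exp\!\big(-\lambda(x-\mu)^2/(2\mu^2x)\big)$, $x>0$. Let $(X_1,\dots,X_n)$ be such that, given $\Theta=\theta$, $X_1,\dots,X_n$ are independent exponential with rate $\theta$; equivalently $$\Pr(X_1>x_1,\dots,X_n>x_n)=\exp\Big\{-\frac{\lambda}{\mu}\Big(\sqrt{1+\tfrac{2\mu^2}{\lambda}\textstyle\sum_{j=1}^n x_j}-1\Big)\Big\},\quad x_j\ge0.$$ Set $c=2\mu^2/\lambda$, $a(x)=\sqrt{1+cx}-1$, $b(x)=\frac{\lambda}{\mu}a(x)$, and $a_j=\frac{(-1)^{j-1}(2j-2)!}{2^{2j-1}(j-1)!}$ for $j\ge1$. Then the pdf of $S_n=X_1+\dots+X_n$ is $$f_{S_n}(x)=\frac{x^{n-1}}{\Gamma(n)}\sum_{k=1}^n(-1)^{n+k}\Big(\frac{\lambda}{\mu}\Big)^k e^{-b(x)}u_{n,k}(x),\qquad x>0,$$ and $f_{S_n}(x)=0$ for $x<0$, where $$u_{n,k}(x)=B_{n,k}\big(a_1c^1(1+cx)^{1/2-1},\,a_2c^2(1+cx)^{1/2-2},\dots,a_{n-k+1}c^{n-k+1}(1+cx)^{1/2-(n-k+1)}\big).$$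
   Context: The partial Bell polynomials are $B_{n,k}(x_1,\dots,x_{n-k+1})=\sum\frac{n!}{j_1!\cdots j_{n-k+1}!}\big(\frac{x_1}{1!}\big)^{j_1}\cdots\big(\frac{x_{n-k+1}}{(n-k+1)!}\big)^{j_{n-k+1}}$, the sum over all non-negative integers $j_1,\dots,j_{n-k+1}$ with $\sum_i j_i=k$ and $\sum_i i\,j_i=n$. *)

(* Defs.v *)
From HB Require Import structures.
From mathcomp Require Import all_boot all_order all_algebra.
From mathcomp Require Import all_classical all_reals all_analysis.
Set Implicit Arguments. Unset Strict Implicit. Unset Printing Implicit Defensive.
Import Order.TTheory GRing.Theory Num.Theory.
Local Open Scope ring_scope.

(* Partial Bell polynomial B_{n,k}(x_1,...,x_{n-k+1}); the variables are
   given as a function x : nat -> R, and only x 1, ..., x (n-k+1) are used.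
   The sum ranges over j_1..j_{n-k+1} (stored at indices 0..n-k) with
   sum j_i = k and sum i j_i = n; each j_i is necessarily <= n. *)
Definition bellB (R : fieldType) (n k : nat) (x : nat -> R) : R :=
  \sum_(j : {ffun 'I_(n - k + 1) -> 'I_n.+1} |
          ((\sum_(i < n - k + 1) nat_of_ord (j i))%N == k) &&
          ((\sum_(i < n - k + 1) (i.+1 * nat_of_ord (j i)))%N == n))
    ((n`!)%:R / (\prod_(i < n - k + 1) ((nat_of_ord (j i))`!)%:R)
     * \prod_(i < n - k + 1) (x i.+1 / ((i.+1)`!)%:R) ^+ (nat_of_ord (j i))).

Definition acoef (R : fieldType) (j : nat) : R :=
  (-1) ^+ (j.-1) * ((2 * j - 2)`!)%:R / ((2 ^ (2 * j - 1))%:R * ((j.-1)`!)%:R).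

Section IG.
Variable R : realType.
Variables (lam mu : R) (n : nat).

Definition cIG : R := 2 * mu ^+ 2 / lam.
Definition aIG (x : R) : R := Num.sqrt (1 + cIG * x) - 1.
Definition bIG (x : R) : R := lam / mu * aIG x.

Definition uIG (k : nat) (x : R) : R :=
  bellB n k (fun j => acoef R j * cIG ^+ j * powR (1 + cIG * x) (2^-1 - j%:R)).

(* Gamma(n) = (n-1)! for n >= 1 *)
Definition fS (x : R) : R :=
  if 0 < x then
    x ^+ n.-1 / ((n.-1)`!)%:R *
    \sum_(1 <= k < n.+1) (-1) ^+ (n + k) * (lam / mu) ^+ k * expR (- bIG x) * uIG k x
  else 0.
End IG.

(* Main.v *)
(* The density is read off from the tail of S_n.  Let G(t) = exp(-b(t)) and
   y_i = G^(i) / i!.  By induction on k, for s, x_j >= 0,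
     P(X_1 + ... + X_k > s, X_j > x_j for j > k)
       = sum_(i < k) (-s)^i y_i(s + sum_(j > k) x_j);
   for k = n and s > 0 the sum telescopes under differentiation in s, and minus
   its derivative is (-1)^n s^(n-1) G^(n)(s) / (n-1)!.  Faa di Bruno's formula
   for G = exp o (-b) turns this into the Bell polynomial expression: both
   sides of it satisfy the recurrence
     (m+1) y_(m+1) = sum_(i <= m) (i+1) p_(i+1) y_(m-i),   p_i = (-b)^(i) / i!,
   which for the Bell polynomials comes from differentiating the generating
   function exp(sum_i p_i X^i). *)
Require Import Defs.
From HB Require Import structures.
From mathcomp Require Import all_boot all_order all_algebra.
From mathcomp Require Import all_classical all_reals all_analysis.
From mathcomp Require Import measurable_realfun.
From mathcomp Require Import ring lra zify.
Import Order.TTheory GRing.Theory Num.Theory.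
Import numFieldNormedType.Exports.
Local Open Scope ring_scope.
Local Open Scope classical_set_scope.

(** * Bell polynomials and their exponential generating function *)

Section BellGeneratingFunction.
Variable F : numFieldType.
Implicit Types (p x : nat -> F) (n m : nat).

(* The product over i of exp(p_{i+1} X^{i+1}), each exponential being truncated
   after its n-th term: its coefficients up to degree n are those of the formal
   power series exp(sum_i p_i X^i). *)
Definition exp_trunc n p : {poly F} :=
  \prod_(i < n) \sum_(m < n.+1) (p i.+1 ^+ m / m`!%:R) *: 'X^(i.+1 * m).

Lemma coef_exp_trunc n p : (exp_trunc n p)`_n =
  \sum_(j : {ffun 'I_n -> 'I_n.+1} | (\sum_(i < n) i.+1 * j i)%N == n)
    \prod_(i < n) (p i.+1 ^+ j i / (j i)`!%:R).
Proof.
rewrite /exp_trunc bigA_distr_bigA coef_sum [RHS]big_mkcond /=.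
apply: eq_bigr => j _; rewrite scaler_prod prodrXr coefZ coefXn eq_sym.
by case: eqP => _; rewrite ?mulr1 ?mulr0.
Qed.

(** Formally exp(a X^(i+1)) has logarithmic derivative (i+1) a X^i; truncation only spoils degrees
    at least [n], which [r] collects. *)
Lemma deriv_trunc_exp n i (a : F) :
  exists r : {poly F},
  deriv (\sum_(m < n.+1) (a ^+ m / m`!%:R) *: 'X^(i.+1 * m)) =
  (i.+1%:R * a) *: 'X^i * (\sum_(m < n.+1) (a ^+ m / m`!%:R) *: 'X^(i.+1 * m))
  + 'X^n * r.
Proof.
(* The term [m = n] of the product on the right, the only one without a counterpart in the
   derivative, with X^n divided out. *)
exists (- ((i.+1%:R * a * (a ^+ n / n`!%:R)) *: 'X^(i + i * n))).
rewrite raddf_sum /= big_ord_recl [X in X + _](_ : _ = 0) ?add0r; last first.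
  by rewrite muln0 derivZ derivXn mulr0n scaler0.
rewrite [X in _ = _ * X + _]big_ord_recr mulrDr.
rewrite -addrA [X in _ = _ + X](_ : _ = 0) ?addr0; last first.
  by rewrite /= -!mul_polyC [in X in _ + X]polyCM mulSn !exprD; ring.
rewrite mulr_sumr; apply: eq_bigr => m _.
have -> (u v : F) (k l : nat) :
    (u *: 'X^k) * (v *: 'X^l) = (u * v) *: 'X^(k + l) :> {poly F}.
  by rewrite -!mul_polyC polyCM exprD; ring.
rewrite derivZ derivXn -scalerMnr scalerMnl -[_ *+ (i.+1 * _)]mulr_natr.
rewrite lift0 (_ : (i.+1 * m.+1).-1 = i + i.+1 * m)%N; last by lia.
congr (_ *: _); rewrite /= factS exprS !natrM.
have h1 : (m.+1)%:R != 0 :> F by rewrite pnatr_eq0.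
have h2 : (m`!)%:R != 0 :> F by rewrite pnatr_eq0 -lt0n fact_gt0.
by field; rewrite h2 [1 + _]addrC natr1 h1.
Qed.

(** Logarithmic derivatives of the factors add up, and under the product rule the errors stay
    multiples of X^n. *)
Lemma deriv_exp_trunc n p : exists r : {poly F},
  deriv (exp_trunc n p) =
  (\poly_(i < n) (i.+1%:R * p i.+1)) * exp_trunc n p + 'X^n * r.
Proof.
rewrite poly_def /exp_trunc.
elim/big_rec2 : _ => [|i /= f g _ [r Hr]].
  by exists 0; rewrite -[in LHS]polyC1 derivC mul0r mulr0 addr0.
have [s Hs] := deriv_trunc_exp n i (p i.+1).
rewrite derivM Hr Hs.
set e := \sum_(m < n.+1) _.
exists (s * g + e * r); move: ((_ * _) *: _) => q.
by rewrite !mulrDl !mulrDr; ring.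
Qed.

Lemma exp_trunc_rec n m p : (m < n)%N ->
  m.+1%:R * (exp_trunc n p)`_m.+1 =
  \sum_(i < m.+1) i.+1%:R * p i.+1 * (exp_trunc n p)`_(m - i).
Proof.
move=> mn; have [r Hr] := deriv_exp_trunc n p.
rewrite mulr_natl -coef_deriv Hr coefD coefXnM mn addr0 coefM.
apply: eq_bigr => i _; rewrite coef_poly (leq_trans (ltn_ord i))//.
Qed.

Lemma exp_trunc0 n p : (exp_trunc n p)`_0 = 1.
Proof.
rewrite -horner_coef0 /exp_trunc horner_prod big1 // => i _.
rewrite horner_sum big_ord_recl /= big1 ?addr0; last first.
  by move=> j _; rewrite hornerZ hornerXn expr0n /bump/= mulr0.
by rewrite hornerZ hornerXn muln0 !expr0 fact0 divr1 mulr1.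
Qed.

(** The complete Bell polynomial in Taylor normalisation, B_n(1! p_1, 2! p_2, ...) / n!: the
    coefficient of X^n in exp(sum_i p_i X^i). *)
Definition bellY n p : F := (exp_trunc n p)`_n.

(** The recurrence does not mention the truncation order, so it determines all coefficients up to
    that order. *)
Lemma exp_trunc_stable n m p : (m <= n)%N -> (exp_trunc n p)`_m = bellY m p.
Proof.
rewrite /bellY; elim/ltn_ind : m n => -[|m] IH n mn; first by rewrite !exp_trunc0.
have h : (m.+1)%:R != 0 :> F by rewrite pnatr_eq0.
apply: (mulfI h); rewrite !exp_trunc_rec//.
apply: eq_bigr => i _; congr (_ * _).
have im : (m - i < m.+1)%N by rewrite ltnS leq_subr.
rewrite (IH _ im) ?(IH _ im m.+1)//; first exact: ltnW.
by rewrite (leq_trans _ mn)// ltnW.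
Qed.

Lemma bellY_rec m p :
  m.+1%:R * bellY m.+1 p = \sum_(i < m.+1) i.+1%:R * p i.+1 * bellY (m - i) p.
Proof.
rewrite exp_trunc_rec//; apply: eq_bigr => i _.
by rewrite exp_trunc_stable// (leq_trans (leq_subr _ _)).
Qed.

Lemma bellY0 p : bellY 0 p = 1.
Proof. exact: exp_trunc0. Qed.

(* Blocks of size more than n - k + 1 cannot occur, so that the indices may
   range over all sizes up to n. *)
Lemma bellB_widen n k x : (0 < k <= n)%N -> bellB n k x =
  \sum_(j : {ffun 'I_n -> 'I_n.+1} |
          ((\sum_(i < n) (j i : nat))%N == k) && ((\sum_(i < n) i.+1 * j i)%N == n))
    (n`!%:R * \prod_(i < n) ((x i.+1 / i.+1`!%:R) ^+ j i / (j i)`!%:R)).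
Proof.
move=> /andP[k0 kn]; set N := (n - k + 1)%N.
have Nn : (N <= n)%N by rewrite /N; lia.
pose g (j : {ffun 'I_N -> 'I_n.+1}) (i : nat) : 'I_n.+1 :=
  if insub i is Some i' then j i' else ord0.
pose ext j : {ffun 'I_n -> 'I_n.+1} := [ffun i : 'I_n => g j i].
pose res (j : {ffun 'I_n -> 'I_n.+1}) : {ffun 'I_N -> 'I_n.+1} :=
  [ffun i => j (widen_ord Nn i)].
have gE j (i : 'I_N) : g j i = j i by rewrite /g insubT//= => ?; congr (j _); exact: val_inj.
have g0 j i : (N <= i)%N -> g j i = ord0 by move=> iN; rewrite /g insubF// ltnNge iN.
have resK j : res (ext j) = j by apply/ffunP => i; rewrite !ffunE/= gE.
have extE (S : Type) (e : S) (op : Monoid.com_law e) (f : nat -> 'I_n.+1 -> S) j :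
    (forall i, f i ord0 = e) ->
    \big[op/e]_(i < n) f i (ext j i) = \big[op/e]_(i < N) f i (j i).
  move=> f0; under [RHS]eq_bigr do rewrite -gE.
  rewrite (big_ord_widen n (fun i => f i (g j i)) Nn).
  rewrite [LHS](bigID (fun i : 'I_n => (i < N)%N))/=.
  rewrite [X in op _ X]big1 ?Monoid.mulm1; last by move=> i; rewrite -leqNgt ffunE => /g0 ->.
  by apply: eq_bigr => i _; rewrite ffunE.
rewrite [RHS](reindex_onto ext res)/=; last first.
  move=> j /andP[/eqP jk /eqP jn]; apply/ffunP => i; rewrite ffunE.
  have [iN|Ni] := ltnP i N.
    by rewrite -[i : nat]/(Ordinal iN : nat) gE ffunE; congr (j _); exact: val_inj.
  rewrite g0//; apply/val_inj => /=; apply/eqP; rewrite eq_sym -leqn0 leqNgt.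
  apply/negP => ji.
  (* A block of size i + 1 > n - k + 1 is too large: n = sum (i+1) j_i would be at least k + i,
     which exceeds n. *)
  have : (\sum_(i < n) (j i : nat) + i * j i <= \sum_(i < n) i.+1 * j i)%N.
    rewrite [X in (_ <= X)%N](eq_bigr (fun i : 'I_n => j i + i * j i)%N) => [|l _]; last by lia.
    by rewrite big_split/= leq_add2l (bigD1 i)//= leq_addr.
  rewrite jk jn; move: Ni ji; rewrite /N; move: (j i : nat) => a.
  by move: (i : nat) kn => b; clear; nia.
rewrite /bellB -/N; apply: eq_big => [j|j _].
  rewrite resK eqxx andbT (extE _ _ _ (fun _ a => a : nat))//.
  by rewrite (extE _ _ _ (fun i a => i.+1 * a)%N)// => i; rewrite muln0.
rewrite (extE _ _ _ (fun i a => (x i.+1 / i.+1`!%:R) ^+ a / a`!%:R)); last first.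
  by move=> i; rewrite expr0 fact0 divr1.
by rewrite -mulrA prodf_div; congr (_ * _); rewrite mulrC.
Qed.

(** Grouping the index vectors by their total k turns z^k into one factor z per block, which the
    variables absorb. The total is at least 1 because [0 < n], and at most n because block sizes are
    at least 1. *)
Lemma sum_bellB n x (z : F) : (0 < n)%N ->
  \sum_(1 <= k < n.+1) z ^+ k * bellB n k x =
  n`!%:R * bellY n (fun j => z * x j / j`!%:R).
Proof.
move=> n0; rewrite /bellY coef_exp_trunc mulr_sumr.
pose s (j : {ffun 'I_n -> 'I_n.+1}) := (\sum_(i < n) (j i : nat))%N.
have sP (j : {ffun 'I_n -> 'I_n.+1}) : (\sum_(i < n) i.+1 * j i)%N == n -> (0 < s j < n.+1)%N.
  move=> /eqP jn; apply/andP; split.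
    rewrite lt0n; apply/negP => /eqP s0; move: n0; rewrite -jn big1// => i _.
    have : (j i <= s j)%N by rewrite /s (bigD1 i)//= leq_addr.
    by rewrite s0 leqn0 => /eqP ->; rewrite muln0.
  by rewrite ltnS -[X in (_ <= X)%N]jn leq_sum// => i _; rewrite leq_pmull.
rewrite [RHS](partition_big (fun j => inord (s j) : 'I_n.+1)
  (fun k : 'I_n.+1 => 0 < k)%N); last first.
  by move=> j /sP/andP[? ?]; rewrite inordK.
rewrite big_add1/= big_mkord [RHS](eq_bigl (fun k : 'I_n.+1 => k != ord0)); last first.
  by move=> k; rewrite lt0n.
rewrite [RHS]big_mkcond/= big_ord_recl/= add0r.
apply: eq_bigr => k _.
rewrite bellB_widen ?ltn_ord// mulr_sumr.
apply: eq_big => [j|j /andP[/eqP jk _]].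
  rewrite andbC; case: eqP => //= /eqP /sP/andP[s0 sn].
  by rewrite -[LHS]/(s j == k.+1) -[in RHS]val_eqE/= inordK.
rewrite mulrCA; congr (_ * _).
rewrite -jk -prodrXr -big_split/=; apply: eq_bigr => i _.
by rewrite mulrA -exprMn mulrA.
Qed.
End BellGeneratingFunction.

(** * Faa di Bruno's formula in recurrence form *)

Section FaaDiBruno.
Variables (R : realType) (D : R -> Prop) (p : nat -> R -> R) (G : R -> R).
Hypothesis dp : forall i x, D x -> is_derive x 1 (p i.+1) (i.+2%:R * p i.+2 x).
Hypothesis dG : forall x, D x -> is_derive x 1 G (G x * p 1%N x).

(** By [dp] and [dG], [p i] acts for i >= 1 as the i-th Taylor coefficient of log G, which makes
    this G^(m) / m!. *)
Definition exp_taylor m x := G x * bellY R m (p^~ x).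

Lemma exp_taylor_rec m x : m.+1%:R * exp_taylor m.+1 x =
  \sum_(i < m.+1) i.+1%:R * p i.+1 x * exp_taylor (m - i) x.
Proof.
rewrite /exp_taylor mulrCA bellY_rec mulr_sumr.
by apply: eq_bigr => i _; rewrite mulrCA.
Qed.

(** Strong induction: differentiating the recurrence for order m + 1 gives m + 1 times the
    recurrence for order m + 2. *)
Lemma is_derive_exp_taylor m x : D x ->
  is_derive x 1 (exp_taylor m) (m.+1%:R * exp_taylor m.+1 x).
Proof.
move=> Dx; elim/ltn_ind : m => -[_|m IH].
  rewrite exp_taylor_rec big_ord1 mul1r /exp_taylor bellY0 mulr1 mulrC.
  by under eq_fun do rewrite bellY0 mulr1; exact: dG.
have m0 : m.+1%:R != 0 :> R by rewrite pnatr_eq0.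
have -> : exp_taylor m.+1 = m.+1%:R^-1 *:
    (\sum_(i < m.+1) (i.+1%:R *: (p i.+1 * exp_taylor (m - i) : R -> R))).
  apply/funext => z; apply: (mulfI m0).
  rewrite exp_taylor_rec /= -[RHS]/(m.+1%:R * (m.+1%:R^-1 * (\sum_(i < m.+1) _) z)).
  rewrite mulVKf// fct_sumE; apply: eq_bigr => i _.
  by rewrite -[RHS]/(_ * (_ * _)) mulrA.
have dT (i : 'I_m.+1) : is_derive x 1 (exp_taylor (m - i))
    ((m - i).+1%:R * exp_taylor (m - i).+1 x).
  by apply: IH; rewrite ltnS leq_subr.
apply: is_derive_eq.
  apply: is_deriveZ; apply: is_derive_sum => i; apply: is_deriveZ.
  apply: is_deriveM; exact: dp.
rewrite -[LHS]/(m.+1%:R^-1 * _); apply: (mulfI m0); rewrite mulVKf//.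
rewrite exp_taylor_rec mulr_sumr.
(* Split m + 1 = (m + 1 - i) + i: the first weight arises from differentiating [exp_taylor], the
   second, after a shift of i, from differentiating [p]. *)
transitivity (\sum_(i < m.+2)
    (((m.+1 - i)%:R + i%:R) * (i.+1%:R * p i.+1 x * exp_taylor (m.+1 - i) x))); last first.
  by apply: eq_bigr => i _; rewrite -natrD subnK// -ltnS.
under [RHS]eq_bigr do rewrite mulrDl.
rewrite [RHS]big_split/= [X in _ = X + _]big_ord_recr [X in _ = _ + X]big_ord_recl/=.
rewrite subnn !mul0r addr0 add0r -big_split/=.
apply: eq_bigr => i _; rewrite /bump/= !add1n subSS subSn; last by rewrite -ltnS.
by rewrite -[LHS]/(_ * (_ * _ + _ * _)); ring.
Qed.
End FaaDiBruno.

(** * Taylor coefficients of the inverse Gaussian survival function *)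

(** With a_1 = 1/2 this makes a_j the falling factorial (1/2)(1/2 - 1)...(1/2 - j + 1), so that a_j
    c^j (1 + c x)^(1/2 - j) is the j-th derivative of sqrt(1 + c x). *)
Lemma acoefS (F : numFieldType) j : acoef F j.+2 = acoef F j.+1 * (2^-1 - j.+1%:R).
Proof.
rewrite /acoef /= (_ : 2 * j.+2 - 2 = (2 * j.+1 - 2).+2)%N; last by lia.
rewrite (_ : 2 * j.+2 - 1 = (2 * j.+1 - 1).+2)%N; last by lia.
set u := (2 * j.+1 - 2)%N; rewrite !factS !natrX !natrM !exprS.
have h : (u.+2)%:R = 2 * j.+1%:R :> F.
  by rewrite -natrM; congr _%:R; rewrite /u; lia.
have h1 : (u.+1)%:R = 2 * j.+1%:R - 1 :> F.
  by rewrite -h -[u.+2%:R]natr1; ring.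
rewrite h h1.
have j0 : (j.+1)%:R != 0 :> F by rewrite pnatr_eq0.
have j1 : (j`!)%:R != 0 :> F by rewrite pnatr_eq0 -lt0n fact_gt0.
have t0 : (2 : F) ^+ (2 * j.+1 - 1) != 0 by rewrite expf_neq0// pnatr_eq0.
move: (2 ^+ _) t0 (j`!%:R) j1 (u`!%:R) ((-1) ^+ j) j.+1%:R j0 => e e0 f f0 v w t t0.
by field; rewrite t0 f0 e0.
Qed.

Section InverseGaussianSurvival.
Variables (R : realType) (lam mu : R).
Hypotheses (lam0 : 0 < lam) (mu0 : 0 < mu).
Let c := cIG lam mu.

Definition survIG (x : R) := expR (- bIG lam mu x).

(** For j >= 1, the Taylor coefficient (-b)^(j)(x) / j!. *)
Definition logTaylorIG (j : nat) (x : R) :=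
  - (lam / mu) * (acoef R j * c ^+ j * powR (1 + c * x) (2^-1 - j%:R)) / j`!%:R.

Let cgt0 : 0 < c.
Proof. by rewrite /c /cIG divr_gt0// mulr_gt0// exprn_gt0. Qed.

Let base_gt0 (x : R) : 0 <= x -> 0 < 1 + c * x.
Proof. by move=> x0; rewrite ltr_wpDr// mulr_ge0// ltW. Qed.

Let is_derive_base (x : R) : is_derive x 1 (fun x : R => 1 + c * x : R) c.
Proof.
have -> : (fun x : R => 1 + c * x) = (cst 1 + c *: id : R -> R) by [].
by apply: is_derive_eq; rewrite add0r -[LHS]/(c * 1) mulr1.
Qed.

Lemma is_derive_logTaylorIG i (x : R) : 0 <= x ->
  is_derive x 1 (logTaylorIG i.+1) (i.+2%:R * logTaylorIG i.+2 x).
Proof.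
move=> x0; have b0 := base_gt0 _ x0.
set a := 2^-1 - i.+1%:R : R.
have H : is_derive x 1 (fun x : R => powR (1 + c * x) a) (a * powR (1 + c * x) (a - 1) * c).
  exact: (@is_derive1_comp R (@powR R ^~ a) (fun x : R => 1 + c * x : R) x _ _
    (is_derive1_powR a b0) (is_derive_base x)).
have -> : logTaylorIG i.+1 = (- (lam / mu) * (acoef R i.+1 * c ^+ i.+1) / i.+1`!%:R)
    *: (fun x : R => powR (1 + c * x) a).
  by apply/funext => z; rewrite -[RHS]/(_ * _) /logTaylorIG; ring.
apply: is_derive_eq; rewrite -[LHS]/(_ * _) /logTaylorIG acoefS -/a.
rewrite (_ : 2^-1 - i.+2%:R = a - 1); last by rewrite /a -[i.+2%:R]natr1; ring.
rewrite (factS i.+1) natrM.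
have j0 : (i.+2)%:R != 0 :> R by rewrite pnatr_eq0.
have j1 : (i.+1`!)%:R != 0 :> R by rewrite pnatr_eq0 -lt0n fact_gt0.
move: (powR _ _) => w; move: (i.+1`!%:R) j1 => f j1; rewrite (exprS _ i.+1).
have m0 : mu != 0 by rewrite gt_eqF.
move: (c ^+ _) (acoef _ _) j0 => ci ac; move: i.+2%:R => j j0. by field; rewrite j0 j1 m0.
Qed.

Lemma is_derive_survIG (x : R) : 0 <= x ->
  is_derive x 1 survIG (survIG x * logTaylorIG 1 x).
Proof.
move=> x0; have b0 := base_gt0 _ x0.
have H : is_derive x 1 (fun x : R => Num.sqrt (1 + c * x)) ((2 * Num.sqrt (1 + c * x))^-1 * c).
  exact: (@is_derive1_comp R Num.sqrt (fun x : R => 1 + c * x : R) x _ _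
    (is_derive1_sqrt b0) (is_derive_base x)).
have H2 : is_derive x 1 (fun x : R => - bIG lam mu x)
    (- (lam / mu * ((2 * Num.sqrt (1 + c * x))^-1 * c))).
  have -> : (fun x : R => - bIG lam mu x) =
    (- ((lam / mu) *: ((fun x : R => Num.sqrt (1 + c * x)) - cst 1)) : R -> R) by [].
  by apply: is_derive_eq; rewrite subr0.
have H3 := @is_derive1_comp R expR (fun x : R => - bIG lam mu x) x _ _ (is_derive_expR _) H2.
apply: (is_derive_eq (f := survIG) H3).
rewrite /survIG; congr (_ * _).
rewrite /logTaylorIG (_ : 2^-1 - 1%:R = - 2^-1); last by lra.
rewrite powRN powR12_sqrt ?ltW// /acoef/= (_ : 2 * 1 - 2 = 0)%N//.
rewrite (_ : 2 * 1 - 1 = 1)%N// !expr0 fact0 expn1 (_ : 1`! = 1)%N // expr1.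
have s0 : Num.sqrt (1 + c * x) != 0 by rewrite gt_eqF// sqrtr_gt0.
have m0 : mu != 0 by rewrite gt_eqF.
by field; rewrite s0 m0.
Qed.

Definition taylorIG := exp_taylor R logTaylorIG survIG.

Lemma taylorIG0 (x : R) : taylorIG 0 x = survIG x.
Proof. by rewrite /taylorIG /exp_taylor bellY0 mulr1. Qed.

Lemma is_derive_taylorIG m (x : R) : 0 <= x ->
  is_derive x 1 (taylorIG m) (m.+1%:R * taylorIG m.+1 x).
Proof.
exact: (is_derive_exp_taylor R (fun x : R => 0 <= x) _ _ is_derive_logTaylorIG is_derive_survIG).
Qed.

(** Since (-1)^(n+k) (lam/mu)^k = (-1)^n (-lam/mu)^k, [sum_bellB] applies with z = -lam/mu; the
    quotient n! / (n-1)! leaves the factor n. *)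
Lemma fSE n (x : R) : (0 < n)%N -> 0 < x ->
  fS lam mu n x = - ((- x) ^+ n.-1 * (n%:R * taylorIG n x)).
Proof.
move=> n0 x0; rewrite /fS x0 /taylorIG /exp_taylor.
rewrite (eq_big_nat _ _ (F2 := fun k => (-1) ^+ n * survIG x *
   ((- (lam / mu)) ^+ k * uIG lam mu n k x))); last first.
  by move=> k _; rewrite exprD -/(survIG x) [(- (lam / mu)) ^+ k]exprNn; ring.
rewrite -mulr_sumr sum_bellB//.
rewrite -/c -[bellY _ _ _]/(bellY R n (logTaylorIG^~ x)).
move: (bellY _ _ _) => w; case: n n0 => // n _ /=.
rewrite factS natrM exprS [(- x) ^+ n]exprNn.
have j1 : (n`!)%:R != 0 :> R by rewrite pnatr_eq0 -lt0n fact_gt0.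
by field; rewrite j1.
Qed.
End InverseGaussianSurvival.

(** * Mean value bounds and functions with quadratic increments *)

Section RealAnalysis.
Variable R : realType.
Implicit Types (f df : R -> R) (a b M : R).

Lemma is_derive_within_continuous f df a b :
  (forall x, a <= x <= b -> is_derive x 1 f (df x)) ->
  {within `[a, b], continuous f}.
Proof.
move=> h; apply: derivable_within_continuous => x; rewrite in_itv/= => /h.
by case.
Qed.

Lemma mean_value_le f df a b M : a <= b ->
  (forall x, a <= x <= b -> is_derive x 1 f (df x)) ->
  (forall x, a <= x <= b -> `|df x| <= M) ->
  `|f b - f a| <= M * (b - a).
Proof.
move=> ab fd dM.
have [x||c cab ->] := @MVT_segment R f df a b ab.
- by rewrite in_itv/= => /andP[? ?]; apply: fd; rewrite !ltW.
- exact: is_derive_within_continuous fd.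
by rewrite normrM [X in _ * X]ger0_norm ?subr_ge0// ler_wpM2r ?subr_ge0// dM.
Qed.

Lemma continuous_norm_bound f a b : a <= b -> {within `[a, b], continuous f} ->
  exists2 M, 0 <= M & forall x, a <= x <= b -> `|f x| <= M.
Proof.
move=> ab cf.
have [c _ hc] := EVT_max ab cf; have [e _ he] := EVT_min ab cf.
exists (`|f c| + `|f e|); first by rewrite addr_ge0.
move=> x xab; have xI : x \in `[a, b]%R by rewrite in_itv.
have := hc _ xI; have := he _ xI => h2 h1.
have := ler_norm (f c); have := lerNnormlW (lexx `|f e|) => h3 h4.
rewrite ler_norml; apply/andP; split; last by rewrite (le_trans h1)// ler_wpDr.
by rewrite (le_trans _ h2)// (le_trans _ h3)// lerN2 ler_wpDl.
Qed.

(** Over N + 1 equal pieces the increments add up to at most M (b - a)^2 / (N + 1), for every N.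
    This stands in for a vanishing derivative when a function is known only through inequalities. *)
Lemma eq_of_quadratic_modulus f a b M : a <= b ->
  (forall x y, a <= x -> x <= y -> y <= b -> `|f y - f x| <= M * (y - x) ^+ 2) ->
  f a = f b.
Proof.
move=> ab fM.
have H (N : nat) : `|f b - f a| * N.+1%:R <= M * (b - a) ^+ 2.
  pose h := (b - a) / N.+1%:R; pose z (i : nat) := a + i%:R * h.
  have N0 : N.+1%:R != 0 :> R by rewrite pnatr_eq0.
  have h0 : 0 <= h by rewrite divr_ge0 ?subr_ge0.
  have zb : z N.+1 = b by rewrite /z /h mulrCA divff// mulr1 addrC subrK.
  have za : z 0%N = a by rewrite /z mul0r addr0.
  have zS i : z i.+1 - z i = h by rewrite /z -natr1; ring.
  have -> : f b - f a = \sum_(0 <= i < N.+1) (f (z i.+1) - f (z i)).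
    by rewrite telescope_sumr// zb za.
  apply: (@le_trans _ _ ((\sum_(0 <= i < N.+1) M * h ^+ 2) * N.+1%:R)).
    rewrite ler_wpM2r//; apply: (le_trans (ler_norm_sum _ _ _)).
    rewrite !big_nat; apply: ler_sum => i /andP[_ iN]; rewrite -[in X in _ <= X](zS i).
    have zle j l : (j <= l)%N -> z j <= z l.
      by move=> jl; rewrite lerD2l ler_wpM2r// ler_nat.
    by apply: fM; rewrite -?zb -?za; apply: zle.
  rewrite sumr_const_nat subn0 -mulr_natr /h.
  by rewrite le_eqVlt; apply/orP; left; apply/eqP; field.
apply/eqP; rewrite eq_sym -subr_eq0 -normr_eq0; apply/negPn/negP => e0.
have {}e0 : 0 < `|f b - f a| by rewrite lt_neqAle eq_sym e0 normr_ge0.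
have B0 : 0 <= M * (b - a) ^+ 2 by apply: le_trans (H 0%N); rewrite mulr_ge0.
have := archi_boundP (divr_ge0 B0 (ltW e0)); set N := Num.Def.archi_bound _.
rewrite ltr_pdivrMr// ltNge => /negP; apply; rewrite mulrC; apply: le_trans (H N).
by rewrite ler_wpM2l// ler_nat.
Qed.

End RealAnalysis.

(** * Mixed Erlang tails *)

Section MixedErlang.
Variables (R : realType) (y : nat -> R -> R).
Hypothesis dy : forall m (x : R), 0 <= x -> is_derive x 1 (y m) (m.+1%:R * y m.+1 x).

(* If y i = G^(i) / i! with G the Laplace transform of Theta, this is the
   expectation of exp (- Theta v) times the probability that a sum of k
   exponential variables of rate Theta exceeds s. *)
Definition erlang_tail k (v s : R) := \sum_(i < k) (- s) ^+ i * y i (s + v).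

Lemma is_derive_oppX k (s : R) :
  is_derive s 1 (fun s : R => (- s) ^+ k) (- (k%:R * (- s) ^+ k.-1)).
Proof.
have -> : (fun s : R => (- s) ^+ k) = ((-%R : R -> R) ^+ k : R -> R).
  by apply/funext => z; rewrite exprfctE.
by apply: is_derive_eq; rewrite -[LHS]/(_ * _) mulrN1.
Qed.

Lemma is_derive_shifted m (v s : R) : 0 <= s + v ->
  is_derive s 1 (fun s : R => y m (s + v)) (m.+1%:R * y m.+1 (s + v)).
Proof.
move=> sv; have H := @is_derive1_comp R (y m) (shift v) s _ _ (dy m _ sv) (is_derive_shift _ _ _).
by apply: (is_derive_eq (f := fun s : R => y m (s + v)) H); rewrite mulr1.
Qed.

(** The sum telescopes: differentiating the power in each new term cancels the derivative of the
    preceding terms. *)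
Lemma is_derive_erlang_tail k (v s : R) : 0 <= s + v ->
  is_derive s 1 (erlang_tail k v) (k%:R * (- s) ^+ k.-1 * y k (s + v)).
Proof.
move=> sv; elim: k => [|k IH].
  rewrite !mul0r (_ : erlang_tail 0 v = cst 0); first exact: is_derive_cst.
  by apply/funext => z; rewrite /erlang_tail big_ord0.
have -> : erlang_tail k.+1 v =
    erlang_tail k v + (fun s => (- s) ^+ k) * (fun s => y k (s + v)).
  by apply/funext => z; rewrite /erlang_tail big_ord_recr.
have H1 := is_derive_oppX k s; have H2 := is_derive_shifted k _ _ sv.
apply: is_derive_eq; rewrite -[LHS]/(_ + (_ * _ + _ * _)) /=; ring.
Qed.

(** The two conditions on v say s - b <= v <= s - a. On [a, b] the derivative is k (-r)^(k-1) (y_k(r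
    + v + t) - y_k(s + t)), with arguments at most b - a apart: a Lipschitz bound gives one factor b
    - a, the mean value theorem the other. *)
Lemma erlang_tail_quadratic k (s t : R) : 0 <= s -> 0 <= t ->
  exists C, forall v a b, 0 <= a -> a <= b -> b <= s ->
    s <= a + v + (b - a) -> b + v - (b - a) <= s -> 0 <= v ->
  `|(erlang_tail k (v + t) b + (- b) ^+ k * y k (s + t)) -
    (erlang_tail k (v + t) a + (- a) ^+ k * y k (s + t))| <= C * (b - a) ^+ 2.
Proof.
move=> s0 t0.
have st0 : 0 <= s + s + t by rewrite !addr_ge0.
(* Both r and v are at most s, so all arguments stay in [0, 2 s + t], where [M] bounds the
   derivative of y_k. *)
have [M M0 HM] : exists2 M, 0 <= M &
    forall x, 0 <= x <= s + s + t -> `|k.+1%:R * y k.+1 x| <= M.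
  apply: continuous_norm_bound => //.
  apply: (@is_derive_within_continuous R _
    (fun x => k.+1%:R * (k.+2%:R * y k.+2 x))) => x /andP[x0 _].
  have H := dy k.+1 _ x0.
  rewrite (_ : (fun x => _) = (k.+1%:R *: y k.+1 : R -> R))//; exact: is_deriveZ.
exists (k%:R * s ^+ k.-1 * M) => v a b a0 ab bs h1 h2 v0.
rewrite expr2 mulrA.
set g := fun r => erlang_tail k (v + t) r + (- r) ^+ k * y k (s + t).
rewrite -[X in `|X|]/(g b - g a).
apply: (@mean_value_le R g
  (fun r => k%:R * (- r) ^+ k.-1 * (y k (r + (v + t)) - y k (s + t)))) => //.
  move=> r /andP[ar rb].
  have H1 : is_derive r 1 (erlang_tail k (v + t)) (k%:R * (- r) ^+ k.-1 * y k (r + (v + t))).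
    by apply: is_derive_erlang_tail; lra.
  have H2 := is_derive_oppX k r.
  rewrite (_ : g = erlang_tail k (v + t) + (y k (s + t)) *: (fun r => (- r) ^+ k)); last first.
    by apply/funext => z; rewrite /g mulrC.
  by apply: is_derive_eq; rewrite -[LHS]/(_ + _ * _); ring.
move=> r /andP[ar rb]; rewrite !normrM -!mulrA ger0_norm// ler_wpM2l// .
rewrite normrX normrN ler_pM//.
  by rewrite ger0_norm; [rewrite lerXn2r// ?nnegrE; lra|lra].
have lip p q : 0 <= p -> p <= q -> q <= s + s + t -> `|y k q - y k p| <= M * (q - p).
  move=> p0 pq qs; apply: (@mean_value_le R (y k) (fun x => k.+1%:R * y k.+1 x)) => //.
    by move=> x /andP[px xq]; apply: dy; lra.
  by move=> x /andP[px xq]; apply: HM; lra.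
have [le|/ltW le] := leP (r + (v + t)) (s + t).
  rewrite distrC; apply: (le_trans (lip _ _ _ _ _)); [lra|lra|lra|].
  by rewrite ler_wpM2l//; lra.
apply: (le_trans (lip _ _ _ _ _)); [lra|lra|lra|].
by rewrite ler_wpM2l//; lra.
Qed.

End MixedErlang.

(** * Probabilities of events: adding one variable to a sum *)

Section Events.
Context {d : measure_display} {T : measurableType d} {R : realType}.
Variable P : probability T R.

Lemma measurable_gt (f : T -> R) u : measurable_fun setT f ->
  measurable [set w | u < f w].
Proof.
move=> mf; have := mf measurableT `]u, +oo[%classic (measurable_itv _).
rewrite setTI; congr measurable; apply/seteqP.
by split => w /=; rewrite in_itv/= andbT.
Qed.

Lemma fine_probability_le (A B : set T) : measurable A -> measurable B ->
  A `<=` B -> fine (P A) <= fine (P B).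
Proof.
move=> mA mB AB; apply: fine_le; rewrite ?fin_num_measure//.
by apply: le_measure; rewrite ?inE.
Qed.

Lemma fine_probabilityD (A B : set T) : measurable A -> measurable B ->
  B `<=` A -> fine (P (A `\` B)) = fine (P A) - fine (P B).
Proof.
move=> mA mB BA; rewrite measureD ?(setIidr BA) ?fineB ?fin_num_measure//.
by rewrite ltey_eq fin_num_measure.
Qed.

(* On the event a < U <= b, the event s < U + V lies between s - a < V and
   s - b < V.  Hence W u = P (s < U + V, u < U, E) has the derivative of
   - (- u)^k y_k (s + t), and W 0 - W s follows. *)
Lemma erlang_tail_step (y : nat -> R -> R) (U V : T -> R) (E : set T) k (t s : R) :
  (forall m (x : R), 0 <= x -> is_derive x 1 (y m) (m.+1%:R * y m.+1 x)) ->
  measurable_fun setT U -> measurable_fun setT V -> measurable E ->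
  E `<=` [set w | 0 < U w] -> E `<=` [set w | 0 < V w] ->
  (0 < k)%N -> 0 <= t -> 0 <= s ->
  (forall u v, 0 <= u -> 0 <= v ->
    P ([set w | u < U w] `&` ([set w | v < V w] `&` E)) = (erlang_tail R y k (v + t) u)%:E) ->
  P ([set w | s < U w + V w] `&` E) = (erlang_tail R y k.+1 t s)%:E.
Proof.
move=> dy mU mV mE EU EV k0 t0 s0 PE.
pose Z := [set w | s < U w + V w] `&` E.
have mZ : measurable Z.
  by apply: measurableI => //; apply: measurable_gt; exact: measurable_funD.
pose W u := fine (P ([set w | u < U w] `&` Z)).
have PW (A : set T) a b : measurable A -> a <= b ->
    fine (P ([set w | a < U w <= b] `&` A)) =
    fine (P ([set w | a < U w] `&` A)) - fine (P ([set w | b < U w] `&` A)).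
  move=> mA ab; rewrite -fine_probabilityD; last 3 first.
  - by apply: measurableI => //; exact: measurable_gt.
  - by apply: measurableI => //; exact: measurable_gt.
  - by move=> w [/= bU Aw]; split => //=; exact: le_lt_trans bU.
  congr (fine (P _)); apply/seteqP; split => w /=.
    move=> [/andP[aU Ub] Aw]; split; first by [].
    by case => + _; rewrite ltNge Ub.
  move=> [[aU Aw] nb]; split => //; rewrite aU/= leNgt; apply/negP => bU.
  by apply: nb.
have mab a b (A : set T) : measurable A -> measurable ([set w | a < U w <= b] `&` A).
  move=> mA; apply: measurableI => //.
  rewrite (_ : [set w | _] = [set w | a < U w] `\` [set w | b < U w]).
    by apply: measurableD; exact: measurable_gt.
  apply/seteqP; split => w /=.
    by move=> /andP[-> Ub]; split => //; apply/negP; rewrite -leNgt.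
  by move=> [-> /negP]; rewrite -leNgt.
have mV' v : measurable ([set w | v < V w] `&` E).
  by apply: measurableI => //; exact: measurable_gt.
have fE u v : 0 <= u -> 0 <= v ->
    fine (P ([set w | u < U w] `&` ([set w | v < V w] `&` E))) = erlang_tail R y k (v + t) u.
  by move=> u0 v0; rewrite PE.
have lower a b : 0 <= a -> a <= b -> b <= s ->
    erlang_tail R y k (s - a + t) a - erlang_tail R y k (s - a + t) b <= W a - W b.
  move=> a0 ab bs; rewrite -!fE//; [|lra..].
  rewrite /W -!PW//; apply: fine_probability_le; [exact: mab|exact: mab|].
  move=> w /= [/andP[aU Ub] [aV Ew]]; split; first by rewrite aU.
  by split => //=; lra.
have upper a b : 0 <= a -> a <= b -> b <= s ->
    W a - W b <= erlang_tail R y k (s - b + t) a - erlang_tail R y k (s - b + t) b.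
  move=> a0 ab bs; rewrite -!fE//; [|lra..].
  rewrite /W -!PW//; apply: fine_probability_le; [exact: mab|exact: mab|].
  move=> w /= [/andP[aU Ub] [/= sUV Ew]]; split; first by rewrite aU.
  by split => //=; lra.
have [C HC] := erlang_tail_quadratic R y dy k s t s0 t0.
(* [erlang_tail_quadratic] at v = s - a and v = s - b shows that [lower] and [upper] both pin the
   decrement of [W] to that of - (- u)^k y_k(s + t), within C (b - a)^2. *)
have W0s : W 0 + (- 0) ^+ k * y k (s + t) = W s + (- s) ^+ k * y k (s + t).
  apply: (@eq_of_quadratic_modulus R (fun u => W u + (- u) ^+ k * y k (s + t)) 0 s C) => //
    a b a0 ab bs.
  have := lower _ _ a0 ab bs; have := upper _ _ a0 ab bs.
  have := HC (s - a) a b a0 ab bs ltac:(lra) ltac:(lra) ltac:(lra).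
  have := HC (s - b) a b a0 ab bs ltac:(lra) ltac:(lra) ltac:(lra).
  rewrite !ler_norml => /andP[h1 h2] /andP[h3 h4] h5 h6.
  by apply/andP; split; lra.
have -> : P Z = (W 0)%:E.
  rewrite /W fineK; last first.
    by rewrite fin_num_measure//; apply: measurableI => //; exact: measurable_gt.
  by congr (P _); rewrite setIidr// => w [_ /EU].
(* The power at 0 vanishes since [0 < k]. On [E], V is positive, so s < U already gives s < U + V,
   and [W s] is the known tail at v = 0; the remaining term is the last summand for [k.+1]. *)
move: W0s; rewrite oppr0 expr0n gtn_eqF// mul0r addr0 => ->.
rewrite /erlang_tail big_ord_recr/=; congr (_ + _)%:E.
rewrite -[RHS](_ : erlang_tail R y k (0 + t) s = _); last by rewrite add0r.
rewrite -fE//; congr (fine (P _)).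
apply/seteqP; split => w /=; first by move=> [sU [sUV Ew]]; split => //; split => //; exact: EV.
by move=> [sU [V0 Ew]]; split => //; split => //=; lra.
Qed.
End Events.

(** * Tail of the sum when the joint survival depends only on the sum of the thresholds *)

Section SchurConstant.
Context {d : measure_display} {T : measurableType d} {R : realType}.
Variables (P : probability T R) (n : nat) (X : 'I_n -> {RV P >-> R}).
Variable y : nat -> R -> R.
Hypothesis dy : forall m (x : R), 0 <= x -> is_derive x 1 (y m) (m.+1%:R * y m.+1 x).
Hypothesis survX : forall x : 'I_n -> R, (forall j, 0 <= x j) ->
  P [set w | forall j, x j < X j w] = (y 0 (\sum_(j < n) x j))%:E.

Lemma measurable_all_gt (x : 'I_n -> R) : measurable [set w | forall j, x j < X j w].
Proof.
rewrite (_ : [set w | _] = \bigcap_(j in setT) [set w | x j < X j w]).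
  apply: fin_bigcap_measurable; first exact: finite_finset.
  by move=> j _; apply: measurable_gt; exact: measurable_funP.
by apply/seteqP; split => w /= h j; [move=> _; exact: h|exact: h].
Qed.

Lemma measurable_partial_sum (Q : pred 'I_n) :
  measurable_fun setT (fun w => \sum_(j < n | Q j) X j w).
Proof.
under eq_fun do rewrite big_mkcond/=.
apply: measurable_sum => j; case: (Q j); first exact: measurable_funP.
exact: measurable_cst.
Qed.

(** Absorbs a condition on one more variable into the threshold vector, so that [survX] or an
    induction hypothesis applies. *)
Lemma all_gt_update (x : 'I_n -> R) (j0 : 'I_n) (v : R) : x j0 <= v ->
  [set w | v < X j0 w] `&` [set w | forall j, x j < X j w] =
  [set w | forall j, (if j == j0 then v else x j) < X j w].
Proof.
move=> xv; apply/seteqP; split => w /=.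
  by move=> [vX xX] j; case: eqP => [->|].
move=> h; split; first by have := h j0; rewrite eqxx.
by move=> j; have := h j; case: eqP => [->|//]; exact: le_lt_trans.
Qed.

Lemma sum_update (x : 'I_n -> R) (j0 : 'I_n) (v : R) : x j0 = 0 ->
  \sum_(j < n) (if j == j0 then v else x j) = v + \sum_(j < n) x j.
Proof.
move=> x0; rewrite (bigD1 j0)//= eqxx [in RHS](bigD1 j0)//= x0 add0r.
by congr (_ + _); apply: eq_bigr => j /negbTE ->.
Qed.

(** Induction on k through [erlang_tail_step], with U the sum so far and V the next variable.
    Thresholds on the later variables stay general because the step needs the hypothesis with that
    of V raised to any v. *)
Lemma partial_sum_tail k : (0 < k <= n)%N -> forall s (x : 'I_n -> R),
  0 <= s -> (forall j, 0 <= x j) -> (forall j : 'I_n, (j < k)%N -> x j = 0) ->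
  P ([set w | s < \sum_(j < n | (j < k)%N) X j w] `&` [set w | forall j, x j < X j w])
  = (erlang_tail R y k (\sum_(j < n) x j) s)%:E.
Proof.
elim: k => // -[|k] IH /andP[_ kn] s x s0 x0 xk.
  pose i0 := Ordinal kn.
  rewrite (_ : [set w | s < _] = [set w | s < X i0 w]); last first.
    apply/seteqP; split => w /=; rewrite (big_pred1 i0)// => j;
      by rewrite /= -val_eqE/= ltnS leqn0.
  rewrite all_gt_update ?xk// survX; last by move=> j; case: eqP.
  by rewrite sum_update ?xk// /erlang_tail big_ord1 expr0 mul1r.
pose i0 := Ordinal kn.
have sumS w : \sum_(j < n | (j < k.+2)%N) X j w =
    \sum_(j < n | (j < k.+1)%N) X j w + X i0 w.
  rewrite (bigD1 i0)/=; last by rewrite ltnS.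
  rewrite addrC; congr (_ + _); apply: eq_bigl => j.
  by rewrite -val_eqE/= ltnS [RHS]ltn_neqAle andbC.
rewrite (_ : [set w | s < _] =
    [set w | s < \sum_(j < n | (j < k.+1)%N) X j w + X i0 w]); last first.
  by apply/seteqP; split => w /=; rewrite sumS.
apply: (erlang_tail_step P y (fun w => \sum_(j < n | (j < k.+1)%N) X j w) (X i0)) => //.
- exact: measurable_partial_sum.
- exact: measurable_all_gt.
- move=> w /= h.
  have n0 : (0 < n)%N := leq_trans (ltn0Sn _) kn.
  have X0 j : 0 < X j w by exact: le_lt_trans (h j).
  rewrite (bigD1 (Ordinal n0))//= ltr_wpDr// sumr_ge0// => j _.
  exact: ltW.
- by move=> w /= h; exact: le_lt_trans (h i0).
- by rewrite sumr_ge0.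
move=> u v u0 v0.
rewrite all_gt_update ?xk// IH//.
- by rewrite sum_update ?xk.
- exact: (ltnW kn).
- by move=> j; case: eqP.
move=> j jk; case: eqP => [ji|_]; first by move: jk; rewrite ji ltnn.
by apply: xk; exact: ltnW.
Qed.

(** Zero thresholds in [partial_sum_tail] give the tail on the event that all variables are
    positive, which has probability [y 0 0 = 1]. *)
Lemma sum_tail s : (0 < n)%N -> 0 <= s -> y 0 0 = 1 ->
  P [set w | s < \sum_(j < n) X j w] = (erlang_tail R y n 0 s)%:E.
Proof.
move=> n0 s0 y00.
pose A := [set w | forall j, 0 < X j w].
have mA : measurable A by exact: measurable_all_gt.
have PA : P (~` A) = 0%E.
  by rewrite probability_setC// survX// big1// y00 subee.
have mS : measurable [set w | s < \sum_(j < n) X j w].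
  by apply: measurable_gt; exact: measurable_partial_sum.
have := partial_sum_tail n; rewrite n0 leqnn => /(_ isT s (fun _ => 0) s0).
rewrite big1// => /(_ (fun _ => lexx _) (fun _ _ => erefl)) <-.
rewrite (_ : [set w | s < \sum_(j < n | _) _] = [set w | s < \sum_(j < n) X j w]); last first.
  have sE w : \sum_(j < n | (j < n)%N) X j w = \sum_(j < n) X j w.
    by apply: eq_bigl => j; rewrite ltn_ord.
  by apply/seteqP; split => w /=; rewrite sE.
rewrite -/A; have := measureDI P mS mA; rewrite [X in (X + _)%E](_ : _ = 0%E) ?add0e//.
apply/eqP; rewrite -measure_le0 -PA; apply: le_measure; rewrite ?inE.
- exact: measurableD.
- exact: measurableC.
- by move=> w [].
Qed.

End SchurConstant.

(** * From a tail function to a density *)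

Section DensityMeasure.
Variables (R : realType) (f : R -> R).
Hypotheses (f0 : forall x, 0 <= f x) (mf : measurable_fun setT f).

(* The proofs are arguments so that the measure instance can be inferred. *)
Definition density_measure of (forall x, 0 <= f x) & measurable_fun setT f :=
  fun V : set R => (\int[lebesgue_measure]_(x in V) (f x)%:E)%E.

Local Notation nu := (density_measure f0 mf).

Let nu0 : nu set0 = 0%E.
Proof. by rewrite /density_measure integral_set0. Qed.

Let nu_ge0 A : (0 <= nu A)%E.
Proof. by rewrite /density_measure integral_ge0//= => x _; rewrite lee_fin. Qed.

Let nu_sigma_additive : semi_sigma_additive nu.
Proof.
move=> /= F mF tF mUF; rewrite /density_measure; apply: cvg_toP.
  apply: ereal_nondecreasing_is_cvgn => m n mn.
  apply: lee_sum_nneg_natr => // k _ _; apply: integral_ge0 => /= x Fkx.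
  by rewrite lee_fin.
rewrite ge0_integral_bigcup//=.
- exact/measurable_funTS/measurableT_comp.
- by move=> x _; rewrite lee_fin.
Qed.

HB.instance Definition _ := isMeasure.Build _ _ _ nu nu0 nu_ge0 nu_sigma_additive.
End DensityMeasure.

Lemma le0_derive_of_nonincreasing (R : realType) (K : R -> R) a (x dK : R) :
  (forall z, a < z -> derivable K z 1) ->
  (forall z t, a < z -> z <= t -> K t <= K z) ->
  a < x -> is_derive x 1 K dK -> dK <= 0.
Proof.
move=> dfK Kle ax dKx.
(* Subtracting e * id makes the monotonicity strict. *)
apply/ler_addgt0Pr => e e0; rewrite add0r -subr_le0.
have De : is_derive x 1 (K - e *: id) (dK - e).
  by apply: is_derive_eq; rewrite -[X in _ - X]/(e * 1) mulr1.
have <- : (K - e *: id)^`() x = dK - e by rewrite derive1E; exact: derive_val.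
apply: (@decr_derive1_le0_itvy R _ false a).
- move=> z; rewrite inE/= in_itv/= andbT => az.
  by apply: derivableB; [exact: dfK|exact: derivableZ].
- move=> z t; rewrite !in_itv/= !andbT => az at_ zt.
  have := Kle _ _ at_ (ltW zt); rewrite -![(K - _) _]/(K _ - e * _).
  have : e * t < e * z by rewrite ltr_pM2l.
  lra.
- by rewrite in_itv/= andbT.
Qed.

(** Both sides are measures in [A] and agree on the intervals ]a, b] by the fundamental theorem of
    calculus; these form a generating class closed under intersection. Nonnegativity of [g] on x > 0
    comes from the monotonicity of the tail. *)
Lemma density_of_tail (R : realType) (Q : probability R R) (K g f : R -> R) :
  (forall s : R, 0 <= s -> Q `]s, +oo[%classic = (K s)%:E) -> K 0 = 1 ->
  (forall s : R, 0 <= s -> is_derive s 1 K (- g s)) ->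
  (forall b, {within `[0, b], continuous g}) ->
  (forall x, f x = if 0 < x then g x else 0) ->
  forall A, measurable A -> Q A = (\int[lebesgue_measure]_(x in A) (f x)%:E)%E.
Proof.
move=> QK K0 dK cg fE.
have dvK z : 0 <= z -> derivable K z 1 by move=> /dK[].
have g0 x : 0 < x -> 0 <= g x.
  move=> x0; rewrite -oppr_le0.
  apply: (@le0_derive_of_nonincreasing R K 0 x) => //.
  - by move=> z z0; apply: dvK; exact: ltW.
  - move=> z t z0 zt; rewrite -lee_fin -!QK ?(ltW z0) ?(le_trans (ltW z0))//.
    apply: le_measure; rewrite ?inE//.
    by apply: subset_itvr; rewrite bnd_simp.
  - by apply: dK; exact: ltW.
have f0 x : 0 <= f x by rewrite fE; case: ifPn => // /g0.
have fR : f = g \_ `]0, +oo[.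
  by apply/funext => x; rewrite fE patchE mem_setE in_itv/= andbT.
have cgx x : 0 < x -> {for x, continuous g}.
  move=> x0; have x1 : x < x + 1 by rewrite ltrDl.
  have /continuous_within_itvP := cg (x + 1).
  move=> /(_ (lt_trans x0 x1))[+ _ _]; apply.
  by rewrite in_itv/= x0.
have mf : measurable_fun setT f.
  rewrite fR; apply: (iffLR (measurable_restrictT g (measurable_itv `]0, +oo[%R))).
  apply: open_continuous_measurable_fun; first exact: interval_open.
  by move=> x; rewrite inE/= in_itv/= andbT; exact: cgx.
(* [K] gives the tail only on s >= 0; since [K 0 = 1] leaves no mass outside ]0, +oo[, thresholds
   can be clipped at 0. *)
have Qgt a : Q `]a, +oo[%classic = (K (Num.max a 0))%:E.
  have [a0|a0] := leP 0 a; first by rewrite QK.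
  apply/eqP; rewrite eq_le; apply/andP; split; first by rewrite K0 probability_le1.
  rewrite -QK//; apply: le_measure; rewrite ?inE//.
  by apply: subset_itvr; rewrite bnd_simp ltW.
move=> A mA; rewrite -[RHS]/(density_measure R f f0 mf A).
have Qoc a b : a <= b -> Q `]a, b]%classic = (K (Num.max a 0) - K (Num.max b 0))%:E.
  move=> ab; rewrite EFinB -!Qgt (_ : `]a, b]%classic = `]a, +oo[ `\` `]b, +oo[); last first.
    apply/seteqP; split => x /=; rewrite !in_itv/= !andbT.
      by move=> /andP[-> xb]; split => //; apply/negP; rewrite -leNgt.
    by move=> [-> /negP]; rewrite -leNgt.
  rewrite measureD; [|exact: measurable_itv|exact: measurable_itv|]; last first.
    by rewrite ltey_eq fin_num_measure//; exact: measurable_itv.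
  by rewrite setIidr//; apply: subset_itvr; rewrite bnd_simp.
have foc a b : a <= b -> density_measure R f f0 mf `]a, b]%classic =
    (K (Num.max a 0) - K (Num.max b 0))%:E.
  move=> ab; rewrite /density_measure.
  set a' := Num.max a 0; set b' := Num.max b 0.
  have a'0 : 0 <= a' by rewrite le_max lexx orbT.
  have ab' : a' <= b' by rewrite ge_max !le_max ab lexx !orbT.
  have -> : (\int[lebesgue_measure]_(x in `]a, b]) (f x)%:E =
             \int[lebesgue_measure]_(x in `]a', b']) (g x)%:E)%E.
    rewrite integral_mkcond [RHS]integral_mkcond; apply: eq_integral => x _.
    rewrite !patchE !mem_setE !in_itv/= /a' /b' fE gt_max le_max.
    case: (ltP 0 x) => x0; last by rewrite !andbF/=; case: ifP.
    by rewrite orbF andbT.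
  move: ab'; rewrite le_eqVlt => /orP[/eqP ->|ab'].
    by rewrite set_itv_ge ?bnd_simp ?ltxx// integral_set0 subrr.
  have cgab : {within `[a', b'], continuous g}.
    by apply: continuous_subspaceW (cg b'); apply: subset_itvr; rewrite bnd_simp.
  rewrite integral_itv_obnd_cbnd; last first.
    apply/measurable_EFinP; apply: (@measurable_funS _ _ _ _ `[a', b']%classic).
    - exact: measurable_itv.
    - by apply: subset_itvr; rewrite bnd_simp.
    - by apply: subspace_continuous_measurable_fun => //; exact: measurable_itv.
  rewrite (@continuous_FTC2 R g (\- K) a' b')//.
  - by rewrite -EFinB/= opprK addrC.
  - have cK z : 0 <= z -> {for z, continuous (\- K)}.
      by move=> z0; apply: differentiable_continuous; apply/derivable1_diffP;
      apply: derivableN; exact: dvK.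
    split.
    + move=> z; rewrite in_itv/= => /andP[az _]; apply: derivableN; apply: dvK.
      exact: le_trans (ltW az).
    + by apply: cvg_at_right_filter; exact: cK.
    + by apply: cvg_at_left_filter; apply: cK; exact: le_trans (ltW ab').
  - move=> z; rewrite in_itv/= => /andP[az _].
    have z0 : 0 <= z by exact: le_trans (ltW az).
    have H := dK _ z0.
    by rewrite derive1E -[LHS]/('D_1 (- K) z) derive_val opprK.
(* The intervals ]-k, k] exhaust the line and have finite mass, as uniqueness requires. *)
apply: (measure_unique (@ocitv R) (fun k => `]- k%:R, k%:R]%classic)) => //.
- exact: ocitvI.
- by move=> i; exact: is_ocitv.
- rewrite -subTset => x _; have [k xk] : exists k : nat, `|x| < k%:R.
    by exists (Num.Def.archi_bound `|x|); exact: archi_boundP.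
  exists k => //=; rewrite in_itv/=.
  by move: xk; rewrite ltr_norml => /andP[-> /ltW].
- move=> _ [[a b] _ <-] /=.
  have [ab|ba] := leP a b; first by rewrite Qoc// -foc.
  by rewrite set_itv_ge ?bnd_simp -?leNgt ?(ltW ba)// !measure0.
- by move=> k; rewrite ltey_eq fin_num_measure//; exact: measurable_itv.
Qed.

(** * The density of the sum in the inverse Gaussian mixture *)

Theorem theorem9 (R : realType) (lam mu : R) (n : nat)
  (d : measure_display) (T : measurableType d) (P : probability T R)
  (X : 'I_n -> {RV P >-> R}) :
  0 < lam -> 0 < mu -> (0 < n)%N ->
  (forall x : 'I_n -> R, (forall j, 0 <= x j) ->
     P [set w | forall j, x j < X j w] =
     (expR (- (lam / mu * (Num.sqrt (1 + 2 * mu ^+ 2 / lam * \sum_(j < n) x j) - 1))))%:E) ->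
  forall A : set R, measurable A ->
    P ((fun w => \sum_(j < n) X j w) @^-1` A) =
    (\int[lebesgue_measure]_(x in A) (fS lam mu n x)%:E)%E.
Proof.
move=> lam0 mu0 n0 HX.
pose y := taylorIG R lam mu.
have dy := is_derive_taylorIG R lam mu lam0 mu0.
have survX (x : 'I_n -> R) : (forall j, 0 <= x j) ->
    P [set w | forall j, x j < X j w] = (y 0 (\sum_(j < n) x j))%:E.
  by move=> x0; rewrite HX// /y taylorIG0.
have y00 : y 0 0 = 1.
  by rewrite /y taylorIG0 /survIG /bIG /aIG mulr0 addr0 sqrtr1 subrr mulr0 oppr0 expR0.
have mS := measurable_partial_sum P n X xpredT.
(* Bundling the sum with its measurability makes its law available as the probability
   [distribution P S]. *)
pose S : {mfun T >-> R} := HB.pack (fun w => \sum_(j < n) X j w)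
  (isMeasurableFun.Build _ _ _ _ (fun w => \sum_(j < n) X j w) mS).
(* Minus the derivative of the tail; it is continuous up to 0 and agrees with [fS] for x > 0 by
   [fSE]. *)
pose g (x : R) := - ((- x) ^+ n.-1 * (n%:R * y n x)).
apply: (density_of_tail R (distribution P S) (erlang_tail R y n 0) g).
- move=> s s0; rewrite -(sum_tail P n X y dy survX s n0 s0 y00).
  rewrite /distribution /pushforward; congr (P _).
  by apply/seteqP; split => w /=; rewrite in_itv/= andbT.
- rewrite /erlang_tail oppr0 add0r; case: (n) n0 => // m _.
  rewrite big_ord_recl expr0 mul1r y00 big1 ?addr0// => i _.
  by rewrite lift0 expr0n mul0r.
- move=> s s0; have s0' : 0 <= s + 0 by rewrite addr0.
  apply: (is_derive_eq (is_derive_erlang_tail R y dy n 0 s s0')).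
  by rewrite /g opprK addr0; ring.
- move=> b; apply: (@is_derive_within_continuous R g (fun x =>
    - ((- x) ^+ n.-1 * (n%:R * (n.+1%:R * y n.+1 x)) +
       (n%:R * y n x) * - (n.-1%:R * (- x) ^+ n.-1.-1)))) => x /andP[x0 _].
  have H1 := is_derive_oppX R n.-1 x; have H2 := dy n _ x0.
  rewrite (_ : g = - ((fun x : R => (- x) ^+ n.-1) * (n%:R *: y n)))//.
  exact: is_derive_eq.
- move=> x; case: ifPn => x0; first by rewrite fSE.
  by rewrite /fS (negbTE x0).
Qed.
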